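(* Let $(X,\mathcal{B},\mu,T)$ be a free, invertible, ergodic probability measure preserving system on a standard probability space and let $M\ge 0$ be an integer. Then there is $A\in\mathcal{B}$ such that $$\frac{1}{N}\sum_{n=M}^{N+M-1}\mu(A\cap T^{n}A)>\mu(A)^{2}$$ for all integers $N\ge 1$.
   Context: The system $(X,\mathcal{B},\mu,T)$ is free if $T^{n}\neq \mathrm{id}$ (as transformations mod $\mu$) for all integers $n\neq 0$. A standard probability space is one isomorphic mod $0$ to a disjoint union of finitely many atoms with an interval equipped with Lebesgue measure. *)

(* Defs.v *)
From HB Require Import structures.
From mathcomp Require Import all_boot all_order all_algebra.
From mathcomp Require Import all_classical all_reals all_analysis.
From mathcomp Require Import measurable_realfun.

Set Implicit Arguments.
Unset Strict Implicit.
Unset Printing Implicit Defensive.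

Import Order.TTheory GRing.Theory Num.Theory.
Import numFieldNormedType.Exports.

Local Open Scope classical_set_scope.
Local Open Scope ring_scope.

(* f, regarded as a map defined on X0 only, is measurable and measure
   preserving from the completion of mu to the completion of nu (it suffices
   to test this on measurable, not merely completion-measurable, sets B).
   On the completed sigma-algebra the outer measure mu^* is the completion of
   mu. Working with completions makes the definition insensitive to whether
   the given sigma-algebra is complete. *)
Definition completion_preserving (R : realType) (d1 d2 : measure_display)
    (X : measurableType d1) (Y : measurableType d2)
    (mu : {measure set X -> \bar R}) (nu : {measure set Y -> \bar R})
    (X0 : set X) (f : X -> Y) : Prop :=
  forall B : set Y, measurable B ->
    completed_algebra_gen mu (X0 `&` f @^-1` B) /\
    (mu^*)%mu (X0 `&` f @^-1` B) = nu B.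

Definition isomorphic_mod0 (R : realType) (d1 d2 : measure_display)
    (X : measurableType d1) (Y : measurableType d2)
    (mu : {measure set X -> \bar R}) (nu : {measure set Y -> \bar R}) : Prop :=
  exists (X0 : set X) (Y0 : set Y) (f : X -> Y) (g : Y -> X),
    [/\ mu.-negligible (~` X0) /\ nu.-negligible (~` Y0),
        set_fun X0 Y0 f /\ set_fun Y0 X0 g,
        {in X0, cancel f g} /\ {in Y0, cancel g f},
        completion_preserving mu nu X0 f &
        completion_preserving nu mu Y0 g].

(* The disjoint union of the interval [0, c] with Lebesgue measure and of k
   atoms of masses p 0, ..., p k.-1, realized inside the real line by placing
   the i-th atom at -(i + 1). *)
Definition interval_with_atoms (R : realType) (c : R) (k : nat)
    (p : nat -> {posnum R}) : {measure set (measurableTypeR R) -> \bar R} :=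
  measure_add
    (mrestr (@lebesgue_measure R) (measurable_itv `[0, c]))
    (msum (fun i => mscale ((p i)%:num%:nng)
      (@dirac _ (measurableTypeR R) (- i.+1%:R : R) R)) k).

Definition standard_probability (R : realType) (d : measure_display)
    (X : measurableType d) (mu : probability X R) : Prop :=
  exists (c : R) (k : nat) (p : nat -> {posnum R}),
    0 <= c /\ isomorphic_mod0 mu (interval_with_atoms c k p).

Record automorphism (R : realType) (d : measure_display)
    (X : measurableType d) (mu : probability X R) := Automorphism {
  aut_fun :> X -> X ;
  aut_inv : X -> X ;
  aut_funK : cancel aut_fun aut_inv ;
  aut_invK : cancel aut_inv aut_fun ;
  measurable_aut_fun : measurable_fun [set: X] aut_fun ;
  measurable_aut_inv : measurable_fun [set: X] aut_inv ;
  aut_preserving :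
    forall A : set X, measurable A -> mu (aut_fun @^-1` A) = mu A }.

Definition aut_iter (R : realType) (d : measure_display)
    (X : measurableType d) (mu : probability X R) (T : automorphism mu)
    (n : int) : X -> X :=
  match n with
  | Posz m => iter m T
  | Negz m => iter m.+1 (aut_inv T)
  end.

Definition ergodic (R : realType) (d : measure_display)
    (X : measurableType d) (mu : probability X R) (T : automorphism mu) : Prop :=
  forall A : set X, measurable A -> T @^-1` A = A -> mu A = 0%E \/ mu A = 1%E.

Definition free_action (R : realType) (d : measure_display)
    (X : measurableType d) (mu : probability X R) (T : automorphism mu) : Prop :=
  forall n : int, n <> 0 -> ~ {ae mu, forall x, aut_iter T n x = x}.

(* Main.v *)
Require Import Defs.
From HB Require Import structures.
From mathcomp Require Import all_boot all_order all_algebra.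
From mathcomp Require Import all_classical all_reals all_analysis.
From mathcomp Require Import measurable_realfun.
From mathcomp Require Import lra ring.

Set Implicit Arguments.
Unset Strict Implicit.
Unset Printing Implicit Defensive.

Import Order.TTheory GRing.Theory Num.Theory.
Import numFieldNormedType.Exports.

Local Open Scope classical_set_scope.
Local Open Scope ring_scope.

(** The set is an increasing union of sets [A k], where [A k.+1] is [A k]
    together with a set [C] of measure about [eps k = 2 ^- (k + 7)] which is
    almost invariant under [T].  Write [corr A n] for
    [mu (A `&` T^n A) - mu A ^ 2] and [corr_sum A N] for its sum over the [N]
    values [M <= n < N + M]; all these sums have to be positive.

    Over a bounded range of [n], almost invariance makes [C] agree with its
    translates, and ergodicity makes it nearly independent of [A] and of
    [A `&` T^n A].  Adding [C] therefore acts like placing [A] in a random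
    environment which is full with probability [mu C]: the common environment
    seen at times [0] and [n] correlates them, and every [corr A n] increases
    by at least [eps / 4] ([corr_union_ge]).

    Over long ranges nothing can be said about single correlations, but only
    their averages matter.  If [A `<=` A'] and [N] is large in terms of [A]
    alone, then by the mean ergodic theorem for [A]
      [average of mu (A' `&` T^n A') >=
         mu A' * mu A + mu A * (mu A' - mu A) - small
         = mu A' ^ 2 - (mu A' - mu A) ^ 2 - small],
    so the loss is quadratic in the measure added ([corr_sum_enlarge_ge]).
    The next enlargement gains a multiple of [eps], which dominates the
    previous loss of order [eps ^ 2]; thus the range of [N] with positive sums
    grows at each stage ([enlarge]), correlations in that range no longer
    decrease, and positivity passes to the limit
    ([positive_correlation_sums]).

    Almost invariant sets of prescribed measure come from a set [B] of tiny
    measure: the union of the first [l] preimages of [B] changes under [T] only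
    by a part of [B], its measure grows with [l] in steps of at most [mu B], and
    ergodicity makes it eventually large ([almost_invariant_exists]).  Tiny
    sets exist because a standard space without them consists, up to a null
    set, of finitely many atoms, which [T] permutes, so that a power of [T] is
    the identity ([free_no_atoms]).

    The mean ergodic theorem is used as a statement about
    [sum_(i < N) mu (D `&` T^-i E)], uniform in the set [D]
    ([mean_ergodic_le], [mean_ergodic_ge]).  It follows from Garsia's maximal
    inequality ([maximal_ergodic]). *)

(** * Probabilities as real numbers, and translates of sets *)

Section real_probability.
Context {R : realType} {d : measure_display} {X : measurableType d}.
Variable mu : probability X R.

Definition rprob (E : set X) : R := fine (mu E).

Lemma rprobE E : measurable E -> mu E = (rprob E)%:E.
Proof. by move=> mE; rewrite /rprob fineK// fin_num_measure. Qed.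

Lemma rprob_ge0 E : 0 <= rprob E.
Proof. exact/fine_ge0/measure_ge0. Qed.

Lemma rprob0 : rprob set0 = 0.
Proof. by rewrite /rprob measure0. Qed.

Lemma rprobC E : measurable E -> rprob (~` E) = 1 - rprob E.
Proof.
by move=> mE; rewrite /rprob probability_setC// rprobE.
Qed.

Lemma le_rprob A B : measurable A -> measurable B -> A `<=` B ->
  rprob A <= rprob B.
Proof.
move=> mA mB AB; rewrite -lee_fin -!rprobE//.
by apply: le_measure; rewrite ?inE.
Qed.

Lemma rprob_le1 E : measurable E -> rprob E <= 1.
Proof. by move=> mE; rewrite -lee_fin -rprobE// probability_le1. Qed.

Lemma rprobU A B : measurable A -> measurable B ->
  rprob (A `|` B) = rprob A + rprob B - rprob (A `&` B).
Proof.
move=> mA mB; apply: EFin_inj; rewrite EFinB EFinD -!rprobE//.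
- by rewrite measureUfinl// ltey_eq fin_num_measure.
- exact: measurableI.
- exact: measurableU.
Qed.

Lemma rprobD A B : measurable A -> measurable B ->
  rprob (A `\` B) = rprob A - rprob (A `&` B).
Proof.
move=> mA mB; apply: EFin_inj; rewrite EFinB -!rprobE//.
- by rewrite measureD// ltey_eq fin_num_measure.
- exact: measurableI.
- exact: measurableD.
Qed.

Lemma rprobU_le A B : measurable A -> measurable B ->
  rprob (A `|` B) <= rprob A + rprob B.
Proof. by move=> mA mB; rewrite rprobU// gerBl rprob_ge0. Qed.

Lemma rprob_le_setDD A B C : measurable A -> measurable B -> measurable C ->
  rprob (A `&` B) <= rprob (A `&` C) + rprob (B `\` C).
Proof.
move=> mA mB mC.
apply: le_trans (rprobU_le (measurableI _ _ mA mC) (measurableD mB mC)).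
apply: le_rprob; [exact: measurableI| |].
  by apply: measurableU; [exact: measurableI|exact: measurableD].
by move=> x [Ax Bx]; have [Cx|nCx] := pselect (C x); [left|right].
Qed.

Lemma rprob_nondecreasing_cvg (F : (set X)^nat) :
  (forall i, measurable (F i)) -> nondecreasing_seq F ->
  rprob (F n) @[n --> \oo] --> rprob (\bigcup_n F n).
Proof.
move=> mF ndF; apply: fine_cvg.
rewrite -rprobE; last exact: bigcup_measurable.
apply: nondecreasing_cvg_mu => //.
exact: bigcup_measurable.
Qed.

Lemma rprob_nonincreasing_cvg (F : (set X)^nat) :
  (forall i, measurable (F i)) -> nonincreasing_seq F ->
  rprob (F n) @[n --> \oo] --> rprob (\bigcap_n F n).
Proof.
move=> mF niF; apply: fine_cvg.
rewrite -rprobE; last exact: bigcap_measurable.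
apply: nonincreasing_cvg_mu => //.
  by rewrite ltey_eq fin_num_measure.
exact: bigcap_measurable.
Qed.

End real_probability.

Section shifts.
Context {R : realType} {d : measure_display} {X : measurableType d}
  {mu : probability X R}.
Variable T : automorphism mu.

Definition pull (n : nat) (E : set X) : set X := iter n T @^-1` E.

Lemma measurable_iter n : measurable_fun [set: X] (iter n T).
Proof.
elim: n => [|n IHn]; first exact: measurable_id.
exact: (measurableT_comp (measurable_aut_fun T) IHn).
Qed.

Lemma measurable_pull n E : measurable E -> measurable (pull n E).
Proof. by move=> mE; rewrite /pull -[_ @^-1` _]setTI; exact: measurable_iter. Qed.

Lemma pull_pull n k E : pull n (pull k E) = pull (k + n) E.
Proof. by apply/funext => x; rewrite /pull /= iterD. Qed.

Lemma pullI n A B : pull n (A `&` B) = pull n A `&` pull n B.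
Proof. by []. Qed.

Lemma rprob_pull n E : measurable E -> rprob mu (pull n E) = rprob mu E.
Proof.
elim: n => // n IHn mE.
rewrite -add1n -pull_pull /rprob -[RHS]/(rprob mu E) -IHn//.
rewrite /rprob -(aut_preserving T (measurable_pull n mE)).
congr (fine (mu _)); apply/funext => x.
by rewrite /pull /= -iterSr.
Qed.

(** Written with the inverse map, a forward translate is visibly
    measurable. *)
Lemma image_iter n E : iter n T @` E = [set x | E (iter n (aut_inv T) x)].
Proof.
have K1 : cancel (iter n T) (iter n (aut_inv T)).
  by elim: n => // n IHn x; rewrite iterSr /= aut_funK.
have K2 : cancel (iter n (aut_inv T)) (iter n T).
  by elim: n {K1} => // n IHn x; rewrite iterSr /= aut_invK.
apply/seteqP; split => x /=.
  by move=> [y Ey <-]; rewrite K1.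
by move=> Ex; exists (iter n (aut_inv T) x).
Qed.

End shifts.

(** * The maximal ergodic inequality *)

Section mean_ergodic.
Context {R : realType} {d : measure_display} {X : measurableType d}
  {mu : probability X R}.
Variable T : automorphism mu.

(** The maximum over [k <= n] of the number of visits to [E] during the first
    [k] steps minus [a * k].  The recursion is the one on which Garsia's proof
    of the maximal inequality rests. *)
Fixpoint excess (E : set X) (a : R) (n : nat) (x : X) : R :=
  if n is n'.+1 then Num.max 0 (\1_E x - a + excess E a n' (T x)) else 0.

Lemma excess_ge0 E a n x : 0 <= excess E a n x.
Proof. by case: n => //= n; rewrite le_max lexx. Qed.

Lemma measurable_excess E a n : measurable E ->
  measurable_fun [set: X] (excess E a n).
Proof.
move=> mE; elim: n => [|n IHn]; first exact: measurable_cst.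
apply: measurable_maxr; first exact: measurable_cst.
apply: measurable_funD.
  apply: measurable_funD; last exact: measurable_cst.
  exact: measurable_indic.
exact: (measurableT_comp IHn (measurable_aut_fun T)).
Qed.

Lemma excess_le_succ E a n x : excess E a n x <= excess E a n.+1 x.
Proof.
elim: n x => [|n IHn] x; first exact: excess_ge0.
rewrite /= -/(excess E a n.+1 (T x)).
rewrite ge_max le_max lexx /= le_max; apply/orP; right.
by rewrite lerD2l; exact: IHn.
Qed.

Lemma excess_homo E a x :
  {homo (excess E a)^~ x : n k / (n <= k)%N >-> n <= k}.
Proof.
apply: homo_leq => //; first exact: le_trans.
by move=> n; exact: excess_le_succ.
Qed.

Lemma visits_le_excess E a n x :
  \sum_(0 <= i < n) \1_(pull T i E) x <= a * n%:R + excess E a n x.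
Proof.
elim: n x => [|n IHn] x; first by rewrite big_nil mulr0 addr0.
rewrite big_nat_recl//.
have shift_indic i : \1_(pull T i.+1 E) x = \1_(pull T i E) (T x) :> R.
  have -> : pull T i.+1 E = T @^-1` pull T i E.
    by apply/funext => y; rewrite /pull /= -iterSr.
  by [].
under eq_bigr do rewrite shift_indic.
apply: le_trans (lerD (lexx _) (IHn _)) _.
have /= : \1_E x - a + excess E a n (T x) <= excess E a n.+1 x.
  by rewrite /= le_max lexx orbT.
rewrite -[n.+1]addn1 natrD mulrDr mulr1; move: (\1_E x) => u.
by lra.
Qed.

Lemma measurable_excess0 E a n : measurable E ->
  measurable [set x | excess E a n x = 0].
Proof.
move=> mE; rewrite -[X in measurable X]setTI.
exact: (measurable_excess a n mE measurableT (measurable_set1 0)).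
Qed.

(** Where [excess E a n.+1] is positive it equals
    [\1_E - a + excess E a n \o T]; where it vanishes, it is at most that
    quantity plus [a].  Integrating, [T] drops out by invariance of [mu], and
    the integral of [excess] cancels because it increases with [n]. *)
Lemma maximal_ergodic E a n : measurable E -> 0 <= a ->
  a <= rprob mu E + a * rprob mu [set x | excess E a n.+1 x = 0].
Proof.
move=> mE a0; set Z := [set x | _].
have mZ : measurable Z by exact: measurable_excess0.
have mF k : measurable_fun [set: X] (EFin \o excess E a k).
  by apply/measurable_EFinP; exact: measurable_excess.
have mFT : measurable_fun [set: X] (fun x => (excess E a n (T x))%:E).
  exact: (measurableT_comp (mF n) (measurable_aut_fun T)).
pose I k := (\int[mu]_x (excess E a k x)%:E)%E.
have integral_const r : (\int[mu]_x r%:E = r%:E)%E.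
  by rewrite integral_cst// -[RHS]mule1; congr (_ * _)%E; exact: probability_setT.
have I_inv : (\int[mu]_x (excess E a n (T x))%:E = I n)%E.
  transitivity (\int[pushforward mu T]_x (excess E a n x)%:E)%E.
    rewrite (ge0_integral_pushforward (measurable_aut_fun T))//.
    - exact: mF.
    - by move=> x _; rewrite lee_fin excess_ge0.
  apply: eq_measure_integral; first exact: measurable_aut_fun.
  by move=> mT A mA _; exact: aut_preserving.
have I_le : (I n <= I n.+1)%E.
  apply: ge0_le_integral; [by []| |exact: mF|exact: mF|] => x _.
    by rewrite lee_fin excess_ge0.
  by rewrite lee_fin; exact: excess_le_succ.
have excess_le k x : excess E a k x <= k%:R.
  elim: k x => // k IHk x /=; rewrite ge_max ler0n /=.
  have := IHk (T x); rewrite -natr1; have : \1_E x <= 1 :> R.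
    by rewrite indicE lern1; case: (_ \in _).
  by move: (\1_E x) => u; lra.
have I_fin : I n \is a fin_num.
  rewrite ge0_fin_numE; last first.
    by apply: integral_ge0 => x _; rewrite lee_fin excess_ge0.
  apply: (@le_lt_trans _ _ (\int[mu]_x (n%:R%:E))%E).
    apply: ge0_le_integral; [by []| |exact: mF|by []|] => x _.
      by rewrite lee_fin excess_ge0.
    by rewrite lee_fin excess_le.
  by rewrite integral_const ltry.
have m1 (A : set X) : measurable A ->
    measurable_fun [set: X] (fun x => (\1_A x : R)%:E).
  by move=> mA; apply/measurable_EFinP; exact: measurable_indic.
have maZ : measurable_fun [set: X] (fun x => (a%:E * (\1_Z x)%:E)%E).
  by apply: measurable_funeM; exact: m1.
(* The constant [a] is added on both sides to stay with nonnegative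
   functions. *)
have H : (\int[mu]_x ((excess E a n.+1 x)%:E + a%:E) <=
          \int[mu]_x ((excess E a n (T x))%:E +
             ((\1_E x)%:E + a%:E * (\1_Z x)%:E)))%E.
  apply: ge0_le_integral; [by []| | | |].
  - by move=> x _; rewrite adde_ge0// lee_fin ?excess_ge0.
  - apply: emeasurable_funD; first exact: mF.
    exact: measurable_cst.
  - by apply: emeasurable_funD => //; apply: emeasurable_funD => //; exact: m1.
  move=> x _; rewrite -EFinM -!EFinD lee_fin.
  have u0 : 0 <= \1_E x :> R by rewrite indicE.
  have Ft0 := excess_ge0 E a n (T x).
  have [Z0|Zn] := eqVneq (excess E a n.+1 x) 0.
    rewrite Z0 [\1_Z x]indicE mem_set//=; move: (\1_E x) u0 Ft0 => u.
    by move: (excess _ _ _ _) => v; lra.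
  rewrite [\1_Z x]indicE memNset//=; last exact/eqP.
  move: Zn => /=; rewrite maxEle; case: ifP => [_ _|]; last by rewrite eqxx.
  by move: (\1_E x) (excess _ _ _ _) => u v; lra.
have HL : (\int[mu]_x ((excess E a n.+1 x)%:E + a%:E) = I n.+1 + a%:E)%E.
  rewrite ge0_integralD ?integral_const//.
  - by move=> x _; rewrite lee_fin excess_ge0.
  - exact: mF.
have HR : (\int[mu]_x ((excess E a n (T x))%:E +
             ((\1_E x)%:E + a%:E * (\1_Z x)%:E)) =
           I n + (mu E + a%:E * mu Z))%E.
  rewrite ge0_integralD//; first last.
  - by apply: emeasurable_funD => //; exact: m1.
  - by move=> x _; rewrite adde_ge0 ?mule_ge0 ?lee_fin.
  - by move=> x _; rewrite lee_fin excess_ge0.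
  rewrite I_inv ge0_integralD//; first last.
  - by move=> x _; rewrite mule_ge0 ?lee_fin.
  - exact: m1.
  rewrite ge0_integralZl_EFin//; last exact: m1.
  by rewrite !integral_indic// !setIT.
rewrite HL HR in H.
have {H I_le} : (I n + a%:E <= I n + (mu E + a%:E * mu Z))%E.
  by apply: le_trans H; rewrite leeD2r.
by rewrite leeD2lE// !rprobE// -EFinM -EFinD lee_fin.
Qed.

End mean_ergodic.

(** * A mean ergodic theorem, uniform over test sets *)

Section uniform_mean_ergodic.
Context {R : realType} {d : measure_display} {X : measurableType d}
  {mu : probability X R}.
Variable T : automorphism mu.
Hypothesis ergT : ergodic T.

(** Unboundedness of the excess in [n] is an exactly invariant property of the
    point, because one application of [T] changes the excess by a bounded
    amount.  By ergodicity it holds almost nowhere or almost everywhere; in the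
    second case the sets where the excess vanishes shrink to a null set, and
    [maximal_ergodic] would give [a <= mu E]. *)
Lemma excess_bounded E a tau : measurable E -> rprob mu E < a -> 0 < tau ->
  exists K : nat, exists G : set X, [/\ measurable G,
    rprob mu (~` G) < tau & forall x n, G x -> excess T E a n x <= K%:R].
Proof.
move=> mE Ea tau0.
have a0 : 0 < a by apply: le_lt_trans Ea; exact: rprob_ge0.
pose U K := [set x | exists n, K%:R < excess T E a n x].
have mU K : measurable (U K).
  rewrite (_ : U K = \bigcup_n (excess T E a n @^-1` `]K%:R, +oo[)).
    apply: bigcup_measurable => n _; rewrite -[X in measurable X]setTI.
    exact: (measurable_excess T a n mE measurableT (measurable_itv _)).
  apply/seteqP; split => x /=.
    by move=> [n Hn]; exists n => //=; rewrite in_itv /= Hn.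
  by move=> [n _ /=]; rewrite in_itv /= andbT => Hn; exists n.
have niU : nonincreasing_seq U.
  move=> i j ij; apply/subsetPset => x [n Hn]; exists n.
  by apply: le_lt_trans Hn; rewrite ler_nat.
pose B := \bigcap_K U K.
have mB : measurable B by apply: bigcap_measurable.
have invB : T @^-1` B = B.
  apply/seteqP; split => x Bx K _.
    have [k ak] : exists k : nat, a <= k%:R.
      exists (Num.trunc a).+1; apply/ltW; exact: truncnS_gt.
    have [n] := Bx (K + k)%N I; rewrite natrD => Hn.
    exists n.+1 => /=; rewrite lt_max; apply/orP; right.
    have : 0 <= \1_E x :> R by rewrite indicE.
    by move: (\1_E x) => u; move: (excess _ _ _ _ _) Hn => v; lra.
  have [n] := Bx K.+1 I; case: n => [|n] /=; first by rewrite ltNge ler0n.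
  rewrite lt_max ltNge ler0n /= => Hn; exists n; move: Hn.
  have : \1_E x <= 1 :> R by rewrite indicE lern1; case: (_ \in _).
  rewrite -natr1; move: (\1_E x) => u; move: (excess _ _ _ _ _) => v.
  by move: a0; lra.
have B_null : rprob mu B = 0.
  have [B0|B1] := ergT mB invB; first by rewrite /rprob B0.
  exfalso.
  pose Z n := [set x | excess T E a n x = 0].
  have mZ n : measurable (Z n) by exact: measurable_excess0.
  have niZ : nonincreasing_seq Z.
    move=> i j ij; apply/subsetPset => x Zx; apply/eqP; rewrite eq_le.
    rewrite excess_ge0 andbT -Zx; exact: excess_homo.
  have Z0 : rprob mu (\bigcap_n Z n) = 0.
    apply/eqP; rewrite eq_le rprob_ge0 andbT.
    have -> : 0 = rprob mu (~` B) by rewrite rprobC// /rprob B1 subrr.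
    apply: le_rprob; [exact: bigcap_measurable|exact: measurableC|].
    move=> x Zx Bx; have [n] := Bx 0%N I.
    by rewrite (Zx n I) ltxx.
  have /cvgr_lt : rprob mu (Z n) @[n --> \oo] --> (0 : R).
    by rewrite -Z0; exact: rprob_nonincreasing_cvg.
  have e0 : 0 < (a - rprob mu E) / a by rewrite divr_gt0 ?subr_gt0.
  move=> /(_ _ e0)[n _ /(_ n.+1 (leqnSn n)) /=].
  rewrite ltr_pdivlMr// => Hn.
  have := maximal_ergodic T n mE (ltW a0).
  by move: Hn; rewrite -/(Z n.+1) [a * _]mulrC; lra.
have /cvgr_lt : rprob mu (U n) @[n --> \oo] --> (0 : R).
  by rewrite -B_null; exact: rprob_nonincreasing_cvg.
move=> /(_ _ tau0)[K _ /(_ K (leqnn K)) /= HK].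
exists K, (~` U K); split; [exact: measurableC|by rewrite setCK|].
by move=> x n nU; rewrite leNgt; apply/negP => Hn; apply: nU; exists n.
Qed.

Lemma sum_rprob_visits_le D E c N : measurable D -> measurable E ->
  (forall x, D x -> \sum_(0 <= i < N) \1_(pull T i E) x <= c) ->
  \sum_(0 <= i < N) rprob mu (D `&` pull T i E) <= c * rprob mu D.
Proof.
move=> mD mE Hc; rewrite -lee_fin EFinM -rprobE// -sumEFin.
rewrite -integral_cst//.
have mP i : measurable (pull T i E) by exact: measurable_pull.
have mI i : measurable_fun D (fun x => (\1_(pull T i E) x : R)%:E).
  by apply/measurable_EFinP; exact: measurable_indic.
rewrite (eq_bigr (fun i => \int[mu]_(x in D) (\1_(pull T i E) x)%:E)%E);
  last first.
    by move=> i _; rewrite integral_indic// setIC -rprobE//; exact: measurableI.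
rewrite -ge0_integral_sum//.
apply: ge0_le_integral => //.
- by move=> x Dx; apply: sume_ge0 => i _; rewrite lee_fin.
- exact: emeasurable_sum.
- by move=> x Dx; rewrite sumEFin lee_fin; exact: Hc.
Qed.

Lemma mean_ergodic_le E tau : measurable E -> 0 < tau ->
  exists N0 : nat, forall N D, (N0 <= N)%N -> measurable D ->
    \sum_(0 <= i < N) rprob mu (D `&` pull T i E)
      <= N%:R * (rprob mu D * rprob mu E + tau).
Proof.
move=> mE tau0; set e := tau / 3; have e0 : 0 < e by rewrite divr_gt0.
have Ea : rprob mu E < rprob mu E + e by rewrite ltrDl.
(* Off a set of measure [e] the number of visits is at most
   [(mu E + e) * N + K]; each of the three errors costs at most [e * N]. *)
have [K [G [mG HG bG]]] := excess_bounded mE Ea e0.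
exists (Num.trunc (K%:R / e)).+1 => N D N0N mD.
have KN : K%:R <= N%:R * e.
  rewrite -ler_pdivrMr//; apply/ltW/(lt_le_trans (truncnS_gt _)).
  by rewrite ler_nat.
have H1 : \sum_(0 <= i < N) rprob mu ((D `&` G) `&` pull T i E) <=
    ((rprob mu E + e) * N%:R + K%:R) * rprob mu (D `&` G).
  apply: sum_rprob_visits_le => //; first exact: measurableI.
  move=> x [_ Gx]; apply: le_trans (visits_le_excess T E (rprob mu E + e) N x) _.
  by rewrite lerD2l; exact: bG.
have H2 : \sum_(0 <= i < N) rprob mu (D `&` pull T i E) <=
    \sum_(0 <= i < N) (rprob mu ((D `&` G) `&` pull T i E) + e).
  apply: ler_sum => i _.
  have mP : measurable (pull T i E) by exact: measurable_pull.
  have mDP : measurable (D `&` pull T i E) by exact: measurableI.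
  have := rprob_le_setDD mu mDP measurableT mG.
  rewrite setIT setIAC setTD => H; apply: le_trans H _.
  by rewrite lerD2l; exact: ltW.
apply: le_trans H2 _; rewrite big_split /= sumr_const_nat subn0 -[e *+ N]mulr_natl.
have DG : rprob mu (D `&` G) <= rprob mu D.
  by apply: le_rprob => //; exact: measurableI.
have H3 : ((rprob mu E + e) * N%:R + K%:R) * rprob mu (D `&` G) <=
    ((rprob mu E + e) * N%:R + K%:R) * rprob mu D.
  apply: ler_wpM2l => //; rewrite addr_ge0// mulr_ge0//.
  by rewrite addr_ge0 ?rprob_ge0// ltW.
have D1 := rprob_le1 mu mD; have D0 := rprob_ge0 mu D.
have H4 : (e * N%:R + K%:R) * rprob mu D <= N%:R * (2 * e).
  apply: le_trans (_ : (e * N%:R + K%:R) * 1 <= _).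
    by apply: ler_wpM2l => //; rewrite addr_ge0// mulr_ge0// ltW.
  by rewrite mulr1 mulrA [e * _]mulrC; lra.
have -> : N%:R * (rprob mu D * rprob mu E + tau) =
    N%:R * rprob mu D * rprob mu E + N%:R * (2 * e) + N%:R * e :> R.
  by rewrite /e; field.
rewrite lerD2r; apply: (le_trans H1); apply: (le_trans H3).
have -> : ((rprob mu E + e) * N%:R + K%:R) * rprob mu D =
  N%:R * rprob mu D * rprob mu E + (e * N%:R + K%:R) * rprob mu D by ring.
by rewrite lerD2l.
Qed.

(** The lower bound is the upper bound for the complement of [D]. *)
Lemma mean_ergodic_ge E tau : measurable E -> 0 < tau ->
  exists N0 : nat, forall N D, (N0 <= N)%N -> measurable D ->
    N%:R * (rprob mu D * rprob mu E - tau)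
      <= \sum_(0 <= i < N) rprob mu (D `&` pull T i E).
Proof.
move=> mE tau0; have [N0 HN0] := mean_ergodic_le mE tau0.
exists N0 => N D N0N mD.
have := HN0 N (~` D) N0N (measurableC mD).
have -> : \sum_(0 <= i < N) rprob mu (~` D `&` pull T i E) =
    N%:R * rprob mu E - \sum_(0 <= i < N) rprob mu (D `&` pull T i E).
  have -> : N%:R * rprob mu E = \sum_(0 <= i < N) rprob mu E.
    by rewrite sumr_const_nat subn0 mulr_natl.
  rewrite -sumrB; apply: eq_bigr => i _.
  have mP : measurable (pull T i E) by exact: measurable_pull.
  by rewrite setIC -setDE rprobD// setIC rprob_pull.
rewrite rprobC//.
have -> : N%:R * ((1 - rprob mu D) * rprob mu E + tau) = N%:R * rprob mu E -
   N%:R * (rprob mu D * rprob mu E - tau) by ring.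
by lra.
Qed.

End uniform_mean_ergodic.

(** * Almost invariant sets *)

Section almost_invariant.
Context {R : realType} {d : measure_display} {X : measurableType d}
  {mu : probability X R}.
Variable T : automorphism mu.
Hypothesis ergT : ergodic T.

Lemma rprob_drift n C : measurable C ->
  rprob mu (C `\` pull T n C) <= n%:R * rprob mu (C `\` pull T 1 C).
Proof.
move=> mC; have mP k : measurable (pull T k C) by exact: measurable_pull.
elim: n => [|n IHn].
  by rewrite mul0r (_ : C `\` pull T 0 C = set0) ?rprob0// setDv.
have step : rprob mu (C `\` pull T n.+1 C) <=
    rprob mu ((C `\` pull T n C) `|` pull T n (C `\` pull T 1 C)).
  apply: le_rprob; first exact: measurableD.
    apply: measurableU; first exact: measurableD.
    by apply: measurable_pull; exact: measurableD.
  move=> x [Cx nCx]; have [Px|nPx] := pselect (pull T n C x); [right|by left].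
  by split.
apply: (le_trans step).
have mD1 : measurable (C `\` pull T 1 C) by exact: measurableD.
apply: le_trans (rprobU_le _ _ _) _.
- exact: measurableD.
- exact: measurable_pull.
by rewrite (rprob_pull T n mD1) -natr1 mulrDl mul1r lerD2r.
Qed.

(** Up to a small error [C] may be replaced by any of its first [N]
    translates, so [mu (E `&` C)] is close to the average over [i < N] of
    [mu (T^-i E `&` C)], which is close to [mu E * mu C]. *)
Lemma almost_invariant_indep E tau : measurable E -> 0 < tau ->
  exists2 eta : R, 0 < eta & forall C, measurable C ->
    rprob mu (C `\` pull T 1 C) <= eta ->
    rprob mu (E `&` C) <= rprob mu E * rprob mu C + tau.
Proof.
move=> mE tau0; have tau2 : 0 < tau / 2 by rewrite divr_gt0.
have [N0 HN0] := mean_ergodic_le ergT mE tau2.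
pose N := N0.+1; have N_gt0 : 0 < N%:R :> R by rewrite ltr0n.
exists (tau / 2 / N%:R) => [|C mC HC]; first by rewrite divr_gt0.
rewrite ler_pdivlMr// mulrC in HC.
have H1 i : (i < N)%N ->
    rprob mu (E `&` C) <= rprob mu (C `&` pull T i E) + tau / 2.
  move=> iN; have mP A : measurable A -> measurable (pull T i A).
    by move=> mA; exact: measurable_pull.
  rewrite -(rprob_pull T i (measurableI _ _ mE mC)) pullI.
  apply: le_trans (rprob_le_setDD mu (mP _ mE) (mP _ mC) mC) _.
  rewrite setIC lerD2l rprobD//; last exact: mP.
  rewrite rprob_pull// setIC -rprobD//; last exact: mP.
  apply: le_trans (rprob_drift i mC) _; apply: le_trans HC.
  by apply: ler_wpM2r; rewrite ?rprob_ge0// ler_nat ltnW.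
have H2 : N%:R * rprob mu (E `&` C) <=
    \sum_(0 <= i < N) (rprob mu (C `&` pull T i E) + tau / 2).
  rewrite mulr_natl -[N in X in X <= _]subn0 -sumr_const_nat !big_mkord.
  by apply: ler_sum => i _; exact: H1.
have H3 := HN0 N C (leqnSn N0) mC.
rewrite -(ler_pM2l N_gt0); apply: (le_trans H2).
rewrite big_split /= sumr_const_nat subn0 -[tau / 2 *+ N]mulr_natl.
have -> : N%:R * (rprob mu E * rprob mu C + tau) =
  N%:R * (rprob mu C * rprob mu E + tau / 2) + N%:R * (tau / 2) by field.
by rewrite lerD2r.
Qed.

Lemma almost_invariant_indep_family (E : (set X)^nat) n tau :
  (forall i, measurable (E i)) -> 0 < tau ->
  exists2 eta : R, 0 < eta & forall C, measurable C ->
    rprob mu (C `\` pull T 1 C) <= eta -> forall i, (i < n)%N ->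
    rprob mu (E i `&` C) <= rprob mu (E i) * rprob mu C + tau.
Proof.
move=> mE tau0; elim: n => [|n [eta eta0 IHn]]; first by exists 1.
have [eta' eta'0 Hn] := almost_invariant_indep (mE n) tau0.
exists (Num.min eta eta') => [|C mC]; first by rewrite lt_min eta0.
rewrite le_min => /andP[C1 C2] i; rewrite ltnS leq_eqVlt => /predU1P[->|ltin].
  exact: Hn.
exact: IHn.
Qed.

(** The union of the preimages [T^-i B] for [i < l] exceeds its own preimage
    only by points of [B]; [l] is taken least such that its measure reaches
    [eps], and the last preimage added has measure [mu B < eps]. *)
Lemma almost_invariant_exists eps eta : 0 < eps -> eps <= 1 / 2 -> 0 < eta ->
  (forall r : R, 0 < r ->
     exists B, [/\ measurable B, 0 < rprob mu B & rprob mu B < r]) ->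
  exists C, [/\ measurable C, eps <= rprob mu C, rprob mu C <= 2 * eps &
    rprob mu (C `\` pull T 1 C) <= eta].
Proof.
move=> eps0 eps2 eta0 small.
have [|B [mB B0]] := small (Num.min eps eta); first by rewrite lt_min eps0.
rewrite lt_min => /andP[Beps Beta].
pose C l := \bigcup_(i in `I_l) pull T i B.
have mP i : measurable (pull T i B) by exact: measurable_pull.
have mC l : measurable (C l) by apply: bigcup_measurable.
have [l Hl] : exists l, eps <= rprob mu (C l).
  (* The complement of the union misses the first translates of [B]
     altogether, so by the mean ergodic theorem it cannot be large. *)
  have [|N0 HN0] := mean_ergodic_ge (tau := rprob mu B / 2) ergT mB.
    by rewrite divr_gt0.
  exists N0.+1; apply: (le_trans eps2).
  have := HN0 N0.+1 _ (leqnSn N0) (measurableC (mC N0.+1)).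
  rewrite big_nat_cond big1; last first.
    move=> i /andP[/andP[_ ltiN] _]; rewrite (_ : _ `&` _ = set0) ?rprob0//.
    by apply/seteqP; split => // x [nCx Px]; apply: nCx; exists i.
  rewrite rprobC// pmulr_rle0 ?ltr0n//.
  have -> : (1 - rprob mu (C N0.+1)) * rprob mu B - rprob mu B / 2 =
    (1 / 2 - rprob mu (C N0.+1)) * rprob mu B by field.
  by rewrite pmulr_lle0// subr_le0.
have exl : exists l, eps <= rprob mu (C l) by exists l.
pose k := ex_minn exl; exists (C k).
have [Hk kmin] : eps <= rprob mu (C k) /\ forall j, eps <= rprob mu (C j) -> (k <= j)%N.
  by rewrite /k; case: ex_minnP.
split => //.
  case: k Hk kmin => [|j] Hj jmin.
    have C0 : C 0%N = set0 by rewrite /C II0 bigcup_set0.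
    by rewrite C0 rprob0; apply: mulr_ge0 => //; exact: ltW.
  have ltj : rprob mu (C j) < eps.
    by rewrite ltNge; apply/negP => /jmin; rewrite ltnn.
  have : rprob mu (C j.+1) <= rprob mu (C j `|` pull T j B).
    apply: le_rprob => //; first exact: measurableU.
    move=> x [i /=]; rewrite ltnS leq_eqVlt => /predU1P[->|ltij] Px; first by right.
    by left; exists i.
  move=> /le_trans /(_ (rprobU_le mu (mC j) (mP j))).
  by rewrite rprob_pull//; lra.
apply: le_trans (ltW Beta); apply: le_rprob => //.
  by apply: measurableD => //; exact: measurable_pull.
move=> x [[[|i] /= ltik Px] nPx]; first by [].
exfalso; apply: nPx; exists i; first exact: ltnW.
by rewrite /pull /= -iterSr.
Qed.

End almost_invariant.

(** * Free systems on standard spaces have sets of small measure *)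

Section no_atoms.
Context {R : realType} {d : measure_display} {X : measurableType d}
  {mu : probability X R}.

Lemma outer_measurableE (A : set X) : measurable A -> (mu^*)%mu A = mu A.
Proof. exact: measurable_mu_extE. Qed.

Lemma outer_eq0_negligible (N : set X) :
  mu.-negligible N -> (mu^*)%mu N = 0%E.
Proof.
move=> [A [mA A0 NA]]; apply/eqP; rewrite eq_le mu_ext_ge0// andbT -A0.
by rewrite -(outer_measurableE mA) le_mu_ext.
Qed.

Lemma completed_negligible (E : set X) :
  completed_algebra_gen mu E -> (mu^*)%mu E = 0%E -> mu.-negligible E.
Proof.
move=> [A mA [N negN <-]] E0; apply: negligibleU => //.
have A_le0 : (mu A <= 0)%E.
  by rewrite -E0 -(outer_measurableE mA) le_mu_ext// => x Ax; left.
by exists A; split => //; apply/eqP; rewrite eq_le A_le0/=.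
Qed.

(** The isomorphism with the model only yields sets of the completed
    sigma-algebra; this brings them back to measurable ones. *)
Lemma completed_measurable_kernel (E : set X) :
  completed_algebra_gen mu E -> exists2 A, measurable A & mu A = (mu^*)%mu E.
Proof.
move=> [A mA [N negN <-]]; exists A => //; rewrite -(outer_measurableE mA).
apply/eqP; rewrite eq_le; apply/andP; split.
  by apply: le_mu_ext => x Ax; left.
apply: le_trans (outer_measureU2 _ _ _) _.
by rewrite [X in (_ + X)%E](outer_eq0_negligible negN) adde0.
Qed.

Section model.
Variables (c : R) (k : nat) (p : nat -> {posnum R}).
Let nu := interval_with_atoms c k p.

Lemma interval_with_atomsE (B : set R) : nu B =
  (lebesgue_measure (B `&` `[0%R, c]) +
   \sum_(i < k) ((p i)%:num)%:E * \d_((- i.+1%:R)%R : R) B)%E.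
Proof. exact: measure_addE. Qed.

Lemma interval_with_atoms_itv t : 0 < t -> t <= c -> nu [set` `[0, t]] = t%:E.
Proof.
move=> t0 tc; rewrite interval_with_atomsE big1 ?adde0; last first.
  move=> i _; rewrite diracE memNset ?mule0//= in_itv /=.
  by rewrite oppr_ge0 lern0.
rewrite setIidl; last first.
  by move=> x /=; rewrite !in_itv /= => /andP[-> /le_trans]; apply.
by rewrite lebesgue_measure_itv /= lte_fin t0 sube0.
Qed.

Lemma interval_with_atoms_atom i : (i < k)%N -> (0 < nu [set (- i.+1%:R)%R])%E.
Proof.
move=> ik; rewrite interval_with_atomsE.
apply: (@lt_le_trans _ _ ((p i)%:num)%:E); first by rewrite lte_fin.
rewrite (bigD1 (Ordinal ik))//= diracE mem_set// mule1.
rewrite addeA addeAC leeDr// adde_ge0//; apply: sume_ge0 => j _.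
by rewrite mule_ge0 ?lee_fin.
Qed.

Lemma interval_with_atoms_outside (B : set R) : c = 0 -> measurable B ->
  (forall i, (i < k)%N -> ~ B (- i.+1%:R)) -> nu B = 0%E.
Proof.
move=> c0 mB HB; rewrite interval_with_atomsE big1 ?adde0; last first.
  by move=> i _; rewrite diracE memNset ?mule0//; exact: HB.
apply/eqP; rewrite eq_le measure_ge0 andbT.
have -> : (0 = lebesgue_measure (`[0%R, c] : set R))%E.
  by rewrite lebesgue_measure_itv /= c0 ltxx.
by apply: le_measure; rewrite ?inE//; exact: measurableI.
Qed.

End model.

Variable T : automorphism mu.

Lemma iter_aut_inj n : injective (iter n T).
Proof.
elim: n => [|n IHn] x y //=.
by move=> /(congr1 (aut_inv T)); rewrite !aut_funK => /IHn.
Qed.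

Lemma negligible_preimage N : mu.-negligible N -> mu.-negligible (T @^-1` N).
Proof.
move=> [A [mA A0 NA]]; exists (T @^-1` A); split.
- by rewrite -[X in measurable X]setTI; exact: (measurable_aut_fun T).
- by rewrite aut_preserving.
- by move=> x /NA.
Qed.

(** Among [x, T x, ..., T^k x] two points carry the same one of the [k]
    labels, so [x] has a period at most [k]; [k`!] serves all [x] at once. *)
Lemma pigeonhole_period (k : nat) (l : X -> nat) (S : set X) :
  (forall x, S x -> S (T x)) -> (forall x, S x -> (l x < k)%N) ->
  (forall x y, S x -> S y -> l x = l y -> x = y) ->
  forall x, S x -> iter k`! T x = x.
Proof.
move=> ST lk linj x Sx.
have Si i : S (iter i T x) by elim: i => //= i; exact: ST.
pose h (i : 'I_k.+1) : 'I_k := Ordinal (lk _ (Si i)).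
have /injectivePn[i [j neq_ij hij]] : ~~ injectiveb h.
  by apply/injectiveP => /leq_card; rewrite !card_ord ltnn.
have eq_ij : iter i T x = iter j T x.
  by apply: linj => //; have /(congr1 val) := hij.
wlog lt_ij : i j neq_ij {hij} eq_ij / (i < j)%N.
  move=> Hw; have := neq_ij; rewrite -val_eqE neq_ltn => /orP[ij|ji].
    exact: (Hw i j).
  by apply: (Hw j i) => //; rewrite eq_sym.
have period : iter (j - i) T x = x.
  by apply: (@iter_aut_inj i); rewrite -iterD subnKC ?(ltnW lt_ij).
have /dvdnP[q ->] : (j - i %| k`!)%N.
  apply: dvdn_fact; rewrite subn_gt0 lt_ij /=.
  by apply: leq_trans (leq_subr _ _) _; rewrite -ltnS.
by elim: q => // q IHq; rewrite mulSn iterD IHq period.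
Qed.

(** If the model has a nondegenerate interval, pull back a short interval.
    Otherwise almost all of [X] is a set [S] of at most [k] points, each of
    which is not negligible.  [T] preserves negligibility, so it maps [S] into
    itself, and [pigeonhole_period] contradicts freeness. *)
Lemma free_no_atoms : standard_probability mu -> free_action T ->
  forall r : R, 0 < r ->
    exists B, [/\ measurable B, 0 < rprob mu B & rprob mu B < r].
Proof.
move=> [c [k [p [c0 [X0 [Y0 [f [g [[negX0 negY0] [fXY gYX] [fK gK] Hf Hg]]]]]]]]].
move=> freeT r r0; have [cpos|cnpos] := ltP 0 c.
  pose t := Num.min c (r / 2).
  have t0 : 0 < t by rewrite lt_min cpos divr_gt0.
  have tc : t <= c by rewrite ge_min lexx.
  have tr : t < r by rewrite gt_min; apply/orP; right; rewrite ltr_pdivrMr//; lra.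
  have [/completed_measurable_kernel[A mA muA] nuA] := Hf [set` `[0, t]] (measurable_itv _).
  exists A; rewrite /rprob muA; move: nuA => /= ->.
  by rewrite (interval_with_atoms_itv _ _ t0 tc).
have {c0 cnpos} c0 : c = 0 by apply/eqP; rewrite eq_le cnpos.
pose P : set R := [set y | exists2 i, (i < k)%N & y = - i.+1%:R].
have mP : measurable (P : set (measurableTypeR R)).
  have -> : P = \bigcup_(i in `I_k) [set - i.+1%:R].
    by apply/seteqP; split => y [i ik ->]; exists i.
  by apply: bigcup_measurable => i _; exact: measurable_set1.
pose S := X0 `&` f @^-1` P.
have negS : mu.-negligible (~` S).
  apply: (@negligibleS _ _ _ _ (~` X0 `|` X0 `&` f @^-1` (~` P))).
    move=> x nSx; have [X0x|] := pselect (X0 x); last by left.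
    by right; split => // Px; apply: nSx.
  apply: negligibleU => //.
  have [cP nuP] := Hf _ (measurableC mP).
  apply: completed_negligible => //.
  move: nuP => /= ->; apply: interval_with_atoms_outside => //.
    exact: measurableC.
  by move=> i ik; apply; exists i.
have atomS x : S x -> ~ mu.-negligible [set x].
  move=> [X0x [i ik fx]] /outer_eq0_negligible x0.
  have [_ /=] := Hf [set (- i.+1%:R : R)] (measurable_set1 _).
  have -> : X0 `&` f @^-1` [set (- i.+1%:R : R)] = [set x].
    apply/seteqP; split => y /= => [[X0y fy]|->]; last by split.
    by rewrite -[y]fK ?inE// fy -fx fK ?inE.
  rewrite x0 => x_null; have := interval_with_atoms_atom c p ik.
  by rewrite lt_neqAle => /andP[/eqP + _]; apply.
have ST x : S x -> S (T x).
  move=> Sx; apply: contrapT => nSTx; apply: (atomS x Sx).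
  have -> : [set x] = T @^-1` [set T x].
    apply/seteqP; split => [_ -> //|y /= /(congr1 (aut_inv T))].
    by rewrite !aut_funK.
  apply: negligible_preimage; apply: negligibleS negS.
  by move=> _ ->.
have [l Hl] : {l : X -> nat & forall x, S x -> (l x < k)%N /\ f x = - (l x).+1%:R}.
  apply: (@choice _ _ (fun x i => S x -> (i < k)%N /\ f x = - i.+1%:R)) => x.
  have [[_ [i ik fx]]|nSx] := pselect (S x); first by exists i.
  by exists 0%N.
exfalso; apply: (freeT (Posz k`!)).
  by move=> /eqP; rewrite eqz_nat eqn0Ngt fact_gt0.
apply: negligibleS negS => x /= nTx Sx; apply: nTx.
apply: (pigeonhole_period ST (l := l) (k := k)) => //.
  by move=> y /Hl[].
move=> y z Sy Sz lyz; have [_ fy] := Hl y Sy; have [_ fz] := Hl z Sz.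
by case: Sy => X0y _; case: Sz => X0z _; rewrite -[y]fK ?inE// fy lyz -fz fK ?inE.
Qed.

End no_atoms.

(** * The effect of an enlargement on correlations *)

Section construction.
Context {R : realType} {d : measure_display} {X : measurableType d}
  {mu : probability X R}.
Variable T : automorphism mu.
Hypothesis ergT : ergodic T.
Variable M : nat.

Definition corr (A : set X) (n : nat) : R :=
  rprob mu (A `&` pull T n A) - rprob mu A ^+ 2.

Definition corr_sum (A : set X) (N : nat) : R :=
  \sum_(0 <= i < N) corr A (i + M).

(** The threshold [N0] depends on [A] only, which is what lets [A'] be chosen
    afterwards.  With [D := A' `\` A], bound [mu (A' `&` T^-n A')] below by
    [mu (A' `&` T^-n A) + mu (A `&` T^-n D)]; both terms average to products
    by the mean ergodic theorem for [A]. *)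
Lemma corr_sum_enlarge_ge A tau : measurable A -> 0 < tau ->
  exists N0 : nat, forall N A', (N0 <= N)%N -> measurable A' -> A `<=` A' ->
    - N%:R * ((rprob mu A' - rprob mu A) ^+ 2 + 2 * tau) <= corr_sum A' N.
Proof.
move=> mA tau0.
have mP n B : measurable B -> measurable (pull T n B).
  by move=> mB; exact: measurable_pull.
have [N1 HN1] := mean_ergodic_ge ergT (mP M _ mA) tau0.
have [N2 HN2] := mean_ergodic_ge ergT mA tau0.
exists (maxn N1 N2) => N A' + mA' AA'; rewrite geq_max => /andP[N1N N2N].
pose D := A' `\` A.
have mD : measurable D by exact: measurableD.
have DE : rprob mu D = rprob mu A' - rprob mu A.
  by rewrite rprobD// (setIidr AA').
have split_corr n : rprob mu (A' `&` pull T n A) + rprob mu (A `&` pull T n D)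
    <= rprob mu (A' `&` pull T n A').
  have mAA : measurable (A' `&` pull T n A) by apply: measurableI => //; exact: mP.
  have mAD : measurable (A `&` pull T n D) by apply: measurableI => //; exact: mP.
  have disj : (A' `&` pull T n A) `&` (A `&` pull T n D) = set0.
    by apply/seteqP; split => // x [[_ Px] [_ [_ nPx]]]; exact: nPx.
  rewrite -[leLHS]subr0 -(rprob0 mu) -disj -rprobU//; apply: le_rprob.
  - exact: measurableU.
  - by apply: measurableI => //; exact: mP.
  - by move=> x [[? Px]|[Ax [Px _]]]; split => //; exact: AA'.
have H1 := HN1 N A' N1N mA'; rewrite rprob_pull// in H1.
(* In [mu (A `&` T^-n D)] the set that moves is [D], which is not fixed in
   advance.  Translating by [T^-j] with [j + n] equal to the last time
   [N.-1 + M] makes [A] move and keeps the test set constant. *)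
have H2 := HN2 N (pull T (N.-1 + M) D) N2N (mP _ _ mD); rewrite rprob_pull// DE in H2.
have E1 : \sum_(0 <= i < N) rprob mu (A' `&` pull T i (pull T M A)) =
    \sum_(0 <= i < N) rprob mu (A' `&` pull T (i + M) A).
  by apply: eq_bigr => i _; rewrite pull_pull addnC.
have E2 : \sum_(0 <= i < N) rprob mu (pull T (N.-1 + M) D `&` pull T i A) =
    \sum_(0 <= i < N) rprob mu (A `&` pull T (i + M) D).
  rewrite [RHS]big_nat_rev; apply: eq_big_nat => i /andP[_ iN] /=.
  rewrite add0n -(rprob_pull T i (E := A `&` _)); last first.
    by apply: measurableI => //; exact: mP.
  rewrite (pullI T i A) pull_pull setIC; congr (rprob mu (_ `&` pull T _ D)).
  by case: N iN {N1N N2N H1 H2 E1} => // N; rewrite ltnS subSS /= => iN; rewrite addnAC subnK.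
rewrite E1 in H1; rewrite E2 in H2.
have -> : corr_sum A' N = \sum_(0 <= i < N) rprob mu (A' `&` pull T (i + M) A') -
    N%:R * rprob mu A' ^+ 2.
  by rewrite /corr_sum /corr sumrB sumr_const_nat subn0 [in RHS]mulr_natl.
have : \sum_(0 <= i < N) (rprob mu (A' `&` pull T (i + M) A) +
      rprob mu (A `&` pull T (i + M) D)) <=
    \sum_(0 <= i < N) rprob mu (A' `&` pull T (i + M) A').
  by apply: ler_sum => i _; exact: split_corr.
rewrite big_split /=; move: H1 H2.
move: (\sum_(0 <= i < N) _) (\sum_(0 <= i < N) _) (\sum_(0 <= i < N) _) => s1 s2 s3.
move: (rprob mu A') (rprob mu A) => a' a H1 H2 H3.
have -> : - N%:R * ((a' - a) ^+ 2 + 2 * tau) =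
  N%:R * (a' * a - tau) + N%:R * ((a' - a) * a - tau) - N%:R * a' ^+ 2 by ring.
by lra.
Qed.

(** The union contains [A `&` T^-n A] and [C `&` T^-n C].  With [a], [c], [q]
    for the measures of [A], [C], [A `&` T^-n A], and up to errors of order
    [e], the new correlation is at least
      [q + c - q * c - (a + (1 - a) * c) ^ 2
         >= q - a ^ 2 + c * (1 - q - 2 * a - c)],
    and the last bracket is at least [1 / 2]. *)
Lemma corr_union_ge A C n eps e : measurable A -> measurable C ->
  eps <= rprob mu C -> rprob mu C <= 1 / 8 -> rprob mu A <= 1 / 8 ->
  0 <= e -> e <= eps / 20 ->
  rprob mu ((A `&` pull T n A) `&` C) <=
    rprob mu (A `&` pull T n A) * rprob mu C + e ->
  rprob mu (~` A `&` C) <= rprob mu (~` A) * rprob mu C + e ->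
  rprob mu (C `\` pull T n C) <= e ->
  corr A n + eps / 4 <= corr (A `|` C) n.
Proof.
move=> mA mC epsC C8 A8 e0 eeps H1 H2 H3.
have mP B : measurable B -> measurable (pull T n B).
  by move=> mB; exact: measurable_pull.
have mAA : measurable (A `&` pull T n A) by apply: measurableI => //; exact: mP.
have mCC : measurable (C `&` pull T n C) by apply: measurableI => //; exact: mP.
have mAC : measurable (A `|` C) by exact: measurableU.
have L1 : rprob mu ((A `&` pull T n A) `|` (C `&` pull T n C)) <=
    rprob mu ((A `|` C) `&` pull T n (A `|` C)).
  apply: le_rprob; first exact: measurableU.
    by apply: measurableI => //; exact: mP.
  by move=> x [[? ?]|[? ?]]; split; [left|left|right|right].
rewrite rprobU// in L1.
have L2 : rprob mu ((A `&` pull T n A) `&` (C `&` pull T n C)) <=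
    rprob mu ((A `&` pull T n A) `&` C).
  apply: le_rprob; [exact: measurableI|exact: measurableI|].
  by move=> x [? [? ?]].
have mPC := mP _ mC.
rewrite rprobD// in H3.
have H4 : rprob mu (A `|` C) = rprob mu A + rprob mu (~` A `&` C).
  by rewrite rprobU// [~` A `&` C]setIC -setDE rprobD// [C `&` A]setIC addrA.
rewrite rprobC// in H2.
have q0 : rprob mu (A `&` pull T n A) <= rprob mu A.
  by apply: le_rprob => // x [].
have A0 := rprob_ge0 mu A.
have D0 := rprob_ge0 mu (~` A `&` C).
rewrite /corr H4.
move: L1 L2 H1 H2 H3 q0 A0 D0 epsC C8 A8.
move: (rprob mu ((A `|` C) `&` pull T n (A `|` C))) => x.
move: (rprob mu ((A `&` pull T n A) `&` (C `&` pull T n C))) => y.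
move: (rprob mu ((A `&` pull T n A) `&` C)) => z.
move: (rprob mu (A `&` pull T n A)) => q.
move: (rprob mu (C `&` pull T n C)) => w.
move: (rprob mu (~` A `&` C)) => v.
move: (rprob mu A) (rprob mu C) => a c.
move=> L1 L2 H1 H2 H3 q0 a0 v0 epsC C8 A8.
have c0 : 0 <= c by lra.
have V : (a + v) ^+ 2 <= (a + (1 - a) * c + e) ^+ 2.
  by apply: lerXn2r; rewrite ?nnegrE; lra.
have b0 : 0 <= (1 - a) * c by apply: mulr_ge0; lra.
have b1 : (1 - a) * c <= 1 / 8.
  by apply: le_trans C8; rewrite ler_piMl//; lra.
have ac0 : 0 <= a * c by exact: mulr_ge0.
have E : (a + (1 - a) * c + e) ^+ 2 =
   a ^+ 2 + 2 * a * ((1 - a) * c) + ((1 - a) * c) ^+ 2 +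
   2 * (a + (1 - a) * c) * e + e ^+ 2 by ring.
have t1 : 2 * a * ((1 - a) * c) <= 2 * (1 / 8) * c.
  apply: ler_pM => //; [lra|lra|].
  by rewrite ler_piMl//; lra.
have t2 : ((1 - a) * c) ^+ 2 <= 1 / 8 * c.
  rewrite expr2; apply: ler_pM => //.
  by rewrite ler_piMl//; lra.
have t3 : 2 * (a + (1 - a) * c) * e <= 2 * (1 / 4) * e.
  by apply: ler_wpM2r => //; lra.
have t4 : e ^+ 2 <= 1 / 2 * e.
  by rewrite expr2; apply: ler_wpM2r => //; lra.
have t5 : q * c <= 1 / 8 * c by nra.
by lra.
Qed.

End construction.

(** * The increasing sequence of sets and its union *)

Section iteration.
Context {R : realType} {d : measure_display} {X : measurableType d}
  {mu : probability X R}.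
Variable T : automorphism mu.
Hypothesis ergT : ergodic T.
Hypothesis small : forall r : R, 0 < r ->
  exists B, [/\ measurable B, 0 < rprob mu B & rprob mu B < r].
Variable M : nat.

(** The hypothesis allows losses of [eps / 8] per unit time.  Up to the time
    [L] the enlargement gains [eps / 4] per unit time; after [L] the sums lose
    at most [5 * eps ^ 2], which is below the [eps / 16] allowed at the next
    stage because [eps <= 1 / 128]. *)
Lemma enlarge A eps K : measurable A -> 0 < eps -> eps <= 1 / 128 ->
  rprob mu A <= 1 / 8 ->
  (forall N, - N%:R * (eps / 8) <= corr_sum T M A N) ->
  exists A', [/\ measurable A' /\ A `<=` A',
    rprob mu A' <= rprob mu A + 2 * eps,
    forall N, - N%:R * (eps / 2 / 8) <= corr_sum T M A' N,
    forall n, (n < K + M)%N -> corr T A n <= corr T A' n &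
    forall N, (0 < N <= K)%N -> 0 < corr_sum T M A' N].
Proof.
move=> mA eps0 eps1 A8 SA.
have mP n B : measurable B -> measurable (pull T n B).
  by move=> mB; exact: measurable_pull.
have tau0 : 0 < eps ^+ 2 / 2 by rewrite divr_gt0// exprn_gt0.
have [N0 HN0] := corr_sum_enlarge_ge ergT M mA tau0.
pose L := maxn N0 K.
pose e := eps / 20; have e0 : 0 < e by rewrite divr_gt0.
have mAA n : measurable (A `&` pull T n A) by apply: measurableI => //; exact: mP.
have [eta1 eta10 Heta1] := almost_invariant_indep_family ergT (L + M) mAA e0.
have [eta2 eta20 Heta2] := almost_invariant_indep ergT (measurableC mA) e0.
pose Q : R := (L + M).+1%:R; have Q0 : 0 < Q by rewrite ltr0n.
pose eta := Num.min (Num.min eta1 eta2) (e / Q).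
have eta0 : 0 < eta by rewrite !lt_min eta10 eta20 divr_gt0.
have eps2 : eps <= 1 / 2 by lra.
have [C [mC epsC C2 HC]] := almost_invariant_exists ergT eps0 eps2 eta0 small.
have etale : eta <= eta1 /\ eta <= eta2 by rewrite !ge_min !lexx /= orbT.
have etaQ : eta * Q <= e by rewrite -ler_pdivlMr// !ge_min lexx orbT.
pose A' := A `|` C.
have mA' : measurable A' by exact: measurableU.
have gain n : (n < L + M)%N -> corr T A n + eps / 4 <= corr T A' n.
  move=> nL; apply: (corr_union_ge mA mC epsC (e := e)) => //.
  - by lra.
  - exact: ltW.
  - by apply: Heta1 => //; apply: le_trans HC _; case: etale.
  - by apply: Heta2 => //; apply: le_trans HC _; case: etale.
  apply: le_trans (rprob_drift T n mC) _; apply: le_trans etaQ.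
  rewrite mulrC; apply: ler_pM => //; first exact: rprob_ge0.
  by rewrite ler_nat; exact/ltnW/ltnW.
have gain_sum N : (N <= L)%N -> N%:R * (eps / 8) <= corr_sum T M A' N.
  move=> NL; have H : \sum_(0 <= i < N) (corr T A (i + M) + eps / 4) <=
      corr_sum T M A' N.
    rewrite /corr_sum !big_mkord; apply: ler_sum => i _; apply: gain.
    by rewrite ltn_add2r; apply: leq_trans NL.
  apply: le_trans H.
  rewrite big_split /= sumr_const_nat subn0 -[eps / 4 *+ N]mulr_natl.
  have := SA N; rewrite /corr_sum; move: (\sum_(0 <= i < N) _) => s Hs.
  have -> : N%:R * (eps / 8) = - N%:R * (eps / 8) + N%:R * (eps / 4) :> R.
    by field.
  by rewrite lerD2r.
have A'le : rprob mu A' <= rprob mu A + 2 * eps.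
  by apply: le_trans (rprobU_le mu mA mC) _; rewrite lerD2l.
exists A'; split => //.
- by split => // x Ax; left.
- move=> N; have [NL|LN] := leqP N L.
    apply: le_trans (gain_sum N NL); apply: (@le_trans _ _ 0).
      by rewrite mulNr oppr_le0 mulr_ge0//; lra.
    by rewrite mulr_ge0//; lra.
  have N0N : (N0 <= N)%N by apply: leq_trans (ltnW LN); exact: leq_maxl.
  have AA' : A `<=` A' by move=> x Ax; left.
  apply: le_trans (HN0 N A' N0N mA' AA').
  rewrite !mulNr lerN2; apply: ler_wpM2l => //.
  have A1 : 0 <= rprob mu A' - rprob mu A by rewrite subr_ge0; exact: le_rprob.
  have A2 : rprob mu A' - rprob mu A <= 2 * eps by lra.
  have : (rprob mu A' - rprob mu A) ^+ 2 <= (2 * eps) ^+ 2.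
    by apply: lerXn2r => //; rewrite nnegrE//; lra.
  have : eps ^+ 2 <= 1 / 128 * eps.
    by rewrite expr2; apply: ler_wpM2r => //; lra.
  by rewrite exprMn; lra.
- move=> n nK; apply: le_trans (gain n _); first by rewrite lerDl; lra.
  by apply: leq_trans nK _; rewrite leq_add2r leq_maxr.
move=> N /andP[N_gt0 NK]; apply: lt_le_trans (gain_sum N _).
  by rewrite mulr_gt0 ?ltr0n ?divr_gt0.
by apply: leq_trans NK _; rewrite leq_maxr.
Qed.

(** Each stage adds measure at most [2 * eps k]; the choice of [eps] keeps the
    total below [4 * eps 0 = 1 / 32], hence below the bound [1 / 8] required by
    [enlarge]. *)
Let eps (k : nat) : R := (1 / 128) / (2 ^ k)%:R.

Lemma eps_gt0 k : 0 < eps k.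
Proof. by rewrite divr_gt0// ltr0n expn_gt0. Qed.

Lemma eps_le k : eps k <= 1 / 128.
Proof.
by rewrite ler_pdivrMr ?ltr0n ?expn_gt0// ler_peMr// ler1n expn_gt0.
Qed.

Lemma eps_half k : eps k / 2 = eps k.+1.
Proof. by rewrite /eps expnS natrM invfM -!mulrA [2^-1 * _]mulrC. Qed.

Definition stage k A := [/\ measurable A, rprob mu A <= 1 / 8 - 4 * eps k &
  forall N, - N%:R * (eps k / 8) <= corr_sum T M A N].

Lemma stage_sequence : exists A : (set X)^nat, forall k,
  [/\ measurable (A k), A k `<=` A k.+1,
    forall n, (n < k.+1 + M)%N -> corr T (A k) n <= corr T (A k.+1) n &
    0 < corr_sum T M (A k.+1) k.+1].
Proof.
have [F HF] : {F : nat * set X -> set X & forall kA, stage kA.1 kA.2 ->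
    [/\ stage kA.1.+1 (F kA), kA.2 `<=` F kA,
    forall n, (n < kA.1.+1 + M)%N -> corr T kA.2 n <= corr T (F kA) n &
    0 < corr_sum T M (F kA) kA.1.+1]}.
  apply: (@choice _ _ (fun kA B => stage kA.1 kA.2 ->
    [/\ stage kA.1.+1 B, kA.2 `<=` B,
    forall n, (n < kA.1.+1 + M)%N -> corr T kA.2 n <= corr T B n &
    0 < corr_sum T M B kA.1.+1])) => -[k A] /=.
  have [[mA A8 SA]|] := pselect (stage k A); last by exists set0.
  have e0 := eps_gt0 k.
  have [|B [[mB AB] B8 SB mono pos]] := enlarge k.+1 mA e0 (eps_le k) _ SA.
    by lra.
  exists B => _; split => //; last by apply: pos; rewrite ltnS leqnn.
  by split => //; rewrite -eps_half//; lra.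
pose A := fix A k := if k is k'.+1 then F (k', A k') else set0.
have stageA k : stage k (A k).
  elim: k => [|k IHk]; last by have [] := HF (k, A k) IHk.
  split => [||N]; first exact: measurable0.
    by rewrite rprob0; have := eps_le 0; lra.
  rewrite /corr_sum big1 => [|i _].
    by rewrite mulNr oppr_le0 mulr_ge0// divr_ge0// ltW// eps_gt0.
  by rewrite /corr set0I rprob0 expr0n subrr.
exists A => k; have [mA _ _] := stageA k.
by have [_ ? ? ?] := HF (k, A k) (stageA k).
Qed.

Lemma bigcup_stages_corr_cvg (A : (set X)^nat) n :
  (forall k, measurable (A k)) -> nondecreasing_seq A ->
  corr T (A k) n @[k --> \oo] --> corr T (\bigcup_k A k) n.
Proof.
move=> mA ndA.
have mP k : measurable (pull T n (A k)) by exact: measurable_pull.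
apply: cvgB.
  rewrite (_ : _ `&` _ = \bigcup_k (A k `&` pull T n (A k))).
    apply: rprob_nondecreasing_cvg => [k|i j ij]; first exact: measurableI.
    have /subsetPset Aij := ndA _ _ ij.
    by apply/subsetPset => x [? ?]; split; exact: Aij.
  apply/seteqP; split => x; last by move=> [k _ [? ?]]; split; exists k.
  move=> [[i _ Ai] [j _ Aj]]; exists (maxn i j) => //.
  have /subsetPset Am := ndA _ _ (leq_maxl i j).
  by have /subsetPset Am' := ndA _ _ (leq_maxr i j); split; [exact: Am|exact: Am'].
rewrite expr2; under eq_fun do rewrite expr2.
by apply: cvgM; exact: rprob_nondecreasing_cvg.
Qed.

(** For fixed [N], the sum over [N] terms is positive at stage [N] and each of
    its terms is nondecreasing from then on. *)
Lemma positive_correlation_sums : exists A, measurable A /\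
  forall N, (0 < N)%N -> 0 < corr_sum T M A N.
Proof.
have [A HA] := stage_sequence.
have mA k : measurable (A k) by have [] := HA k.
have ndA : nondecreasing_seq A.
  by apply/nondecreasing_seqP => k; apply/subsetPset; have [] := HA k.
exists (\bigcup_k A k); split; first exact: bigcup_measurable.
move=> [//|N] _; have [_ _ _ pos] := HA N.
apply: (lt_le_trans pos); rewrite /corr_sum !big_mkord.
apply: ler_sum => -[i /= iN] _; set n := (i + M)%N.
have mono k : (N < k)%N -> corr T (A N.+1) n <= corr T (A k) n.
  elim: k => // k IHk; rewrite ltnS leq_eqVlt => /predU1P[->//|Nk].
  apply: (le_trans (IHk Nk)); have [_ _ + _] := HA k; apply.
  by rewrite ltn_add2r (leq_trans iN)// (leq_trans Nk).
have /cvg_lim <- // := bigcup_stages_corr_cvg (n := n) mA ndA.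
apply: limr_ge; first by apply/cvg_ex; eexists; exact: bigcup_stages_corr_cvg.
by exists N.+1 => // k /= Nk; exact: mono.
Qed.

End iteration.

Theorem theorem1p8 (R : realType) (d : measure_display) (X : measurableType d)
  (mu : probability X R) (T : automorphism mu) (M : nat) :
  standard_probability mu -> ergodic T -> free_action T ->
  exists A : set X, measurable A /\
    forall N : nat, (1 <= N)%N ->
      (mu A ^+ 2 <
       (N%:R^-1)%:E * \sum_(M <= n < N + M) mu (A `&` aut_iter T (Posz n) @` A))%E.
Proof.
move=> stdmu ergT freeT.
have [A [mA HA]] := positive_correlation_sums ergT (free_no_atoms stdmu freeT) M.
exists A; split => // N N1.
have muE n : mu (A `&` aut_iter T (Posz n) @` A) = (rprob mu (A `&` pull T n A))%:E.
  have mI : measurable (iter n T @` A).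
    rewrite image_iter -[X in measurable X]setTI.
    have mi : measurable_fun [set: X] (iter n (aut_inv T)).
      elim: n => [|n IHn]; first exact: measurable_id.
      exact: (measurableT_comp (measurable_aut_inv T) IHn).
    exact: mi.
  rewrite rprobE/=; last exact: measurableI.
  congr (_%:E); rewrite -(rprob_pull T n (measurableI _ _ mA mI)).
  congr (rprob mu _); apply/seteqP; split => x /=.
    move=> [Ax [y Ay]] /iter_aut_inj xy; split => //.
    by rewrite -xy.
  by move=> [Ax Px]; split => //; exists x.
under eq_bigr do rewrite muE.
rewrite sumEFin rprobE// -EFin_expe -EFinM lte_fin.
rewrite mulrC ltr_pdivlMr ?ltr0n//.
rewrite -[X in \sum_(X <= _ < _) _]add0n big_addn addnK.
have := HA N N1; rewrite /corr_sum /corr sumrB sumr_const_nat subn0.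
by rewrite -[rprob mu A ^+ 2 *+ N]mulr_natr subr_gt0.
Qed.
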